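(* Let $(Q,\cdot)$ be a group and let $(F,A)$ be a soft set over $Q$. Then $(F,A)_{(Q,\cdot)}$ is a soft group if and only if any of the following statements is true (that is, being a soft group is equivalent to each one of them): (1) $(F,A)_{(Q,\cdot)}$ is a soft loop; (2) $(F,A)_{(Q,/)}$ is a soft groupoid; (3) $(F,A)_{(Q,\backslash)}$ is a soft groupoid.
   Context: A groupoid is a nonempty set with a binary operation. A quasigroup is a groupoid $(Q,\cdot)$ in which for all $a,b\in Q$ each of the equations $a\cdot x=b$ and $y\cdot a=b$ has a unique solution in $Q$. A loop is a quasigroup with a two-sided identity element. In a quasigroup (in particular a group) $(Q,\cdot)$ the operations $/$ and $\backslash$ on $Q$ are defined by $x\backslash y=z\Leftrightarrow x\cdot z=y$ and $x/y=z\Leftrightarrow z\cdot y=x$. A nonempty subset $H\subseteq Q$ is a subgroupoid (subquasigroup, subloop, subgroup) of $(Q,\ast)$ if $H$ is closed under $\ast$ and $(H,\ast)$ is a groupoid (quasigroup, loop, group) under the restricted operation. A soft set $(F,A)$ over a set $Q$ consists of a set $A$ of parameters and a map $F:A\to 2^{Q}\setminus\{\emptyset\}$. For a binary operation $\ast$ on $Q$, $(F,A)_{(Q,\ast)}$ denotes this soft set regarded over $(Q,\ast)$; it is called a soft groupoid (soft loop, soft group) if $F(a)$ is a subgroupoid (subloop, subgroup) of $(Q,\ast)$ for all $a\in A$. *)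

(* Defs.v *)
From mathcomp Require Import all_boot.
From mathcomp Require Import boolp classical_sets.

Set Implicit Arguments.
Unset Strict Implicit.
Unset Printing Implicit Defensive.

Local Open Scope classical_set_scope.

Section Structures.
Variable T : Type.
Implicit Type op : T -> T -> T.

Definition is_groupoid op : Prop := [set: T] !=set0.

Definition is_quasigroup op : Prop :=
  is_groupoid op /\
  forall a b : T, (exists! x, op a x = b) /\ (exists! y, op y a = b).

Definition is_loop op : Prop :=
  is_quasigroup op /\ exists e : T, left_id e op /\ right_id e op.

Definition is_group op : Prop :=
  associative op /\
  exists e : T, [/\ left_id e op, right_id e op &
    forall x, exists y, op y x = e /\ op x y = e].

(* x \ y *)
Definition is_left_division op (ldiv : T -> T -> T) : Prop :=
  forall x y z, ldiv x y = z <-> op x z = y.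

(* x / y *)
Definition is_right_division op (rdiv : T -> T -> T) : Prop :=
  forall x y z, rdiv x y = z <-> op z y = x.

End Structures.

Section Substructures.
Variable Q : Type.
Implicit Types (op : Q -> Q -> Q) (H : set Q).

Definition op_closed op H : Prop := forall x y, H x -> H y -> H (op x y).

(* [H], used as a type, is the sigma type [set_type H] of the elements of Q
   that lie in H. *)
Definition restr_op op H (clH : op_closed op H) : H -> H -> H :=
  fun x y => SigSub (mem_set (clH _ _ (set_valP x) (set_valP y))).

Definition subgroupoid op H : Prop :=
  exists clH : op_closed op H, is_groupoid (restr_op clH).

Definition subloop op H : Prop :=
  exists clH : op_closed op H, is_loop (restr_op clH).

Definition subgroup op H : Prop :=
  exists clH : op_closed op H, is_group (restr_op clH).

End Substructures.

Record soft_set (A Q : Type) := SoftSet {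
  soft_map :> A -> set Q;
  soft_map_neq0 : forall a, soft_map a !=set0
}.

Section Soft.
Variables (A Q : Type).
Implicit Types (op : Q -> Q -> Q) (F : soft_set A Q).

Definition soft_groupoid op F : Prop := forall a, subgroupoid op (F a).
Definition soft_loop op F : Prop := forall a, subloop op (F a).
Definition soft_group op F : Prop := forall a, subgroup op (F a).

End Soft.

(* Every [groupType] is a group in the above sense, and it has both divisions
   (which are unique by definition). *)
Section GroupType.
Variable Q : groupType.
Local Open Scope group_scope.

Lemma groupType_is_group : is_group (@mul Q).
Proof.
split; first exact: mulgA.
exists 1; split; [exact: mul1g | exact: mulg1 | move=> x].
by exists x^-1; rewrite mulVg mulgV.
Qed.

Lemma groupType_left_division :
  is_left_division (@mul Q) (fun x y => x^-1 * y).
Proof. by move=> x y z; split=> <-; rewrite ?mulVKg ?mulKg. Qed.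

Lemma groupType_right_division : is_right_division (@mul Q) (fun x y => x / y).
Proof. by move=> x y z; split=> <-; rewrite ?mulgVK ?mulgK. Qed.

End GroupType.

(* Main.v *)
Require Import Defs.
From mathcomp Require Import all_boot.
From mathcomp Require Import boolp classical_sets.

(** The soft statement holds parameter by parameter, so it reduces to a fact
    about one nonempty subset [H] of a group: being a subgroup, being a subloop,
    being closed under [/] and being closed under [\] are equivalent. These
    properties imply each other in a cycle.

    A group is a loop because its equations are solved by [a^-1 * b] and
    [b * a^-1] ([group_is_loop]). In a subloop the equation [z * y = x] has a
    solution inside [H], and that solution must be the quotient [x / y] of the
    ambient group ([subloop_rdiv_closed]). Finally, either division alone
    recovers the whole group structure of [H]: it gives the identity as [x / x]
    or [x \ x], then inverses as [1 / x] or [x \ 1], then the product and the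
    other division by dividing with inverses ([rdiv_closed_ldiv_closed],
    [ldiv_closed_subgroup]). *)

Lemma group_is_loop (T : Type) (op : T -> T -> T) : is_group op -> is_loop op.
Proof.
move=> [opA [e [op1 opr1 opV]]]; split; last by exists e.
split=> [|a b]; first by exists e.
have [c [ca ac]] := opV a; split.
  exists (op c b); split=> [|x <-]; first by rewrite opA ac op1.
  by rewrite opA ca op1.
exists (op b c); split=> [|y <-]; first by rewrite -opA ca opr1.
by rewrite -opA ac opr1.
Qed.

Lemma op_closed_subgroupoid (Q : Type) (op : Q -> Q -> Q) (H : set Q) :
  nonempty H -> op_closed op H -> subgroupoid op H.
Proof. by move=> [x Hx] clH; exists clH; exists (SigSub (mem_set Hx)). Qed.

Lemma subgroup_subloop (Q : Type) (op : Q -> Q -> Q) (H : set Q) :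
  subgroup op H -> subloop op H.
Proof. by move=> [clH grH]; exists clH; exact: group_is_loop. Qed.

(** A solution of [z * y = x] found inside [H] also solves the equation in [Q],
    where [x / y] is the only solution. *)
Lemma subloop_rdiv_closed (Q : Type) (op rdiv : Q -> Q -> Q) (H : set Q) :
  is_right_division op rdiv -> subloop op H -> op_closed rdiv H.
Proof.
move=> rdivP [clH [[_ solH] _]] x y Hx Hy.
have [_ [z [zyx _]]] := solH (SigSub (mem_set Hy)) (SigSub (mem_set Hx)).
have /rdivP -> : op (val z) y = x by have := congr1 val zyx.
exact: set_valP.
Qed.

Section GroupDivisions.
Variables (Q : groupType) (rdiv ldiv : Q -> Q -> Q) (H : set Q).
Hypotheses (rdivP : is_right_division (@mul Q) rdiv)
  (ldivP : is_left_division (@mul Q) ldiv) (H0 : nonempty H).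
Local Open Scope group_scope.

Lemma rdivE x y : rdiv x y = x / y.
Proof. by apply/rdivP; rewrite mulgVK. Qed.

Lemma ldivE x y : ldiv x y = x^-1 * y.
Proof. by apply/ldivP; rewrite mulVKg. Qed.

(** The point is that [x \ y = x^-1 / y^-1], where [x^-1 = (x / x) / x]. *)
Lemma rdiv_closed_ldiv_closed : op_closed rdiv H -> op_closed ldiv H.
Proof.
move=> clH; have HV x : H x -> H x^-1.
  by move=> Hx; have := clH _ _ (clH _ _ Hx Hx) Hx; rewrite !rdivE mulgV mul1g.
move=> x y Hx Hy; have := clH _ _ (HV _ Hx) (HV _ Hy).
by rewrite rdivE invgK -ldivE.
Qed.

(** Dually, [x^-1 = x \ (x \ x)] and [x * y = x^-1 \ y]; associativity is
    inherited from [Q]. *)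
Lemma ldiv_closed_subgroup : op_closed ldiv H -> subgroup (@mul Q) H.
Proof.
move=> clH.
have H1 : H 1.
  by case: H0 => x Hx; have := clH _ _ Hx Hx; rewrite ldivE mulVg.
have HV x : H x -> H x^-1.
  by move=> Hx; have := clH _ _ Hx H1; rewrite ldivE mulg1.
have HM : op_closed (@mul Q) H.
  by move=> x y Hx Hy; have := clH _ _ (HV _ Hx) Hy; rewrite ldivE invgK.
exists HM; split; first by move=> x y z; apply: val_inj; exact: mulgA.
exists (SigSub (mem_set H1)); split=> x.
- by apply: val_inj; exact: mul1g.
- by apply: val_inj; exact: mulg1.
exists (SigSub (mem_set (HV _ (set_valP x)))).
by split; apply: val_inj; [exact: mulVg | exact: mulgV].
Qed.

Lemma subgroup_division_criteria :
  [<-> subgroup (@mul Q) H; subloop (@mul Q) H;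
       subgroupoid rdiv H; subgroupoid ldiv H].
Proof.
tfae.
- exact: subgroup_subloop.
- by move/(subloop_rdiv_closed _ _ _ _ rdivP); exact: op_closed_subgroupoid.
- by case=> clH _; apply: op_closed_subgroupoid (rdiv_closed_ldiv_closed clH).
- by case=> clH _; exact: ldiv_closed_subgroup.
Qed.

End GroupDivisions.

Theorem theorem3p1 (Q : groupType) (A : Type) (F : soft_set A Q)
    (rdiv ldiv : Q -> Q -> Q)
    (rdivP : is_right_division (@mul Q) rdiv)
    (ldivP : is_left_division (@mul Q) ldiv) :
  (soft_group (@mul Q) F <-> soft_loop (@mul Q) F) /\
  (soft_group (@mul Q) F <-> soft_groupoid rdiv F) /\
  (soft_group (@mul Q) F <-> soft_groupoid ldiv F).
Proof.
have crit a := subgroup_division_criteria _ _ _ _ rdivP ldivP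
  (soft_map_neq0 F a).
split; [|split]; split=> SF a.
- exact/(crit a 0 1)/SF.
- exact/(crit a 0 1)/SF.
- exact/(crit a 0 2)/SF.
- exact/(crit a 0 2)/SF.
- exact/(crit a 0 3)/SF.
- exact/(crit a 0 3)/SF.
Qed.
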